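(* Consider, for each $n$, the Bayesian working model with inverse gamma priors (parameters $\alpha,\beta>0$) on the error variances described in the context, with slowly varying function $L$ nondecreasing and satisfying $0<L(u)\le M<\infty$, and with Bayes estimators $\hat\theta_i=\mathbb{E}(1-\kappa_i\mid X_i)X_i$ computed with global parameter $\tau=\tau_n$. Let the data be generated as $X_i\sim N(\theta_{0i},\sigma_{0i}^2)$ independently, $i=1,\dots,n$, with $(\theta_{01},\dots,\theta_{0n})\in L_0(q_n)$. Assume (i) $\max_{1\le i\le n}\sigma_{0i}^2=O(1)$, (ii) $q_n=o(n)$, $a+1<\alpha<a+2$, and additionally $\max_{1\le i\le n}|\theta_{0i}|=O(1)$. Let $0<\eta<\min(a,1/2)$, choose $\tau_n=(q_n/n)^{\frac{1}{2\eta}(1+\epsilon_n)}$, where $\epsilon_n\to0$ as $n\to\infty$, and let $M_n\to\infty$. Then $$\lim_{n\to\infty}\ \sup_{(\theta_{01},\dots,\theta_{0n})\in L_0(q_n)}\ \sum_{i=1}^n\mathbb{P}_{0i}\big[(\hat\theta_i-\theta_{0i})^2>M_n\,q_n\log(n/q_n)\big]=0,$$ where the supremum is over vectors in $L_0(q_n)$ satisfying the bound $\max_{1\le i\le n}|\theta_{0i}|=O(1)$ (i.e. $\max_{1\le i\le n}|\theta_{0i}|\le B$ for a fixed constant $B$ not depending on $n$).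
   Context: Working model (for given $n$ and $\tau>0$): (i) $X_i\mid\theta_i,\sigma_i^2\sim N(\theta_i,\sigma_i^2)$ independently, $i=1,\dots,n$; (ii) $\theta_i\mid\sigma_i^2,\lambda_i^2,\tau^2\sim N(0,\sigma_i^2\lambda_i^2\tau^2)$ independently; (iii) $\lambda_1^2,\dots,\lambda_n^2,\sigma_1^2,\dots,\sigma_n^2$ are mutually independent, each $\lambda_i^2$ having the proper prior density $\Pi(\lambda_i^2)=K(\lambda_i^2)^{-a-1}L(\lambda_i^2)$ on $(0,\infty)$, with $a>0$, $K>0$ the normalizing constant, and $L$ a slowly varying function (at infinity); (iv) each $\sigma_i^2$ has the inverse gamma prior density $\Pi(\sigma_i^2)=\frac{\beta^\alpha}{\Gamma(\alpha)}(\sigma_i^2)^{-\alpha-1}\exp(-\beta/\sigma_i^2)$ on $(0,\infty)$, $\alpha,\beta>0$. Standing assumption on $L$: it is nondecreasing and $0<L(u)\le M<\infty$ for all $u>0$. The shrinkage factor is $\kappa_i=(1+\lambda_i^2\tau^2)^{-1}$, and $\mathbb{E}(\cdot\mid X_i)$ denotes posterior expectation given $X_i$ under the working model. $q_n$ is a sequence of positive numbers, and $L_0(q_n)=\{(\theta_{01},\dots,\theta_{0n})\in\mathbb{R}^n:\sum_{i=1}^n I_{[\theta_{0i}\ne0]}\le q_n\}$. The true means $\theta_{0i}$ and true variances $\sigma_{0i}^2>0$ are fixed, and $\mathbb{P}_{0i}$ denotes probability when $X_i\sim N(\theta_{0i},\sigma_{0i}^2)$. *)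

(* Defs.v *)
From HB Require Import structures.
From mathcomp Require Import all_boot all_order all_algebra.
From mathcomp Require Import all_classical all_reals all_analysis.

Set Implicit Arguments.
Unset Strict Implicit.
Unset Printing Implicit Defensive.

Import Order.TTheory GRing.Theory Num.Theory.
Import numFieldNormedType.Exports.

Local Open Scope classical_set_scope.
Local Open Scope ring_scope.

(* Measurability of [L] is not required: below, [L] is nondecreasing on
   (0, +oo). *)
Definition slowly_varying {R : realType} (L : R -> R) : Prop :=
  forall c : R, 0 < c -> L (c * u) / L u @[u --> +oo] --> (1 : R).

Definition Gamma {R : realType} (z : R) : R :=
  fine (\int[lebesgue_measure]_(t in `]0%R, +oo[)
          (t `^ (z - 1) * expR (- t))%:E)%E.

Definition inv_gamma_pdf {R : realType} (alpha beta s2 : R) : R :=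
  beta `^ alpha / Gamma alpha * s2 `^ (- alpha - 1) * expR (- (beta / s2)).

Definition local_prior {R : realType} (K a : R) (L : R -> R) (l2 : R) : R :=
  K * l2 `^ (- a - 1) * L l2.

(* Joint density, at (l2, s2, th, x), of (lambda_i^2, sigma_i^2, theta_i, X_i)
   in the hierarchical model.  The second argument of [normal_pdf] is a
   standard deviation. *)
Definition joint_pdf {R : realType} (K a : R) (L : R -> R) (alpha beta tau : R)
    (l2 s2 th x : R) : R :=
  normal_pdf th (Num.sqrt s2) x *
  normal_pdf 0 (Num.sqrt (s2 * l2 * tau ^+ 2)) th *
  local_prior K a L l2 * inv_gamma_pdf alpha beta s2.

(* Bayes' formula for E(g(lambda_i^2, sigma_i^2, theta_i) | X_i = x), for
   nonnegative [g]; the denominator is the marginal density of X_i at x. *)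
Definition posterior_mean {R : realType} (K a : R) (L : R -> R)
    (alpha beta tau : R) (g : R -> R -> R -> R) (x : R) : R :=
  let I (h : R -> R -> R -> R) : \bar R :=
    (\int[lebesgue_measure]_(l2 in `]0%R, +oo[)
      \int[lebesgue_measure]_(s2 in `]0%R, +oo[)
        \int[lebesgue_measure]_(th in [set: R])
          (h l2 s2 th * joint_pdf K a L alpha beta tau l2 s2 th x)%:E)%E in
  fine (I g) / fine (I (fun _ _ _ => 1)).

Definition kappa {R : realType} (tau l2 : R) : R := (1 + l2 * tau ^+ 2)^-1.

Definition theta_hat {R : realType} (K a : R) (L : R -> R)
    (alpha beta tau : R) (x : R) : R :=
  posterior_mean K a L alpha beta tau (fun l2 _ _ => 1 - kappa tau l2) x * x.

Definition nearly_black {R : realType} (n : nat) (q : R) : set ('I_n -> R) :=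
  [set theta | \sum_(i < n) (theta i != 0)%:R <= q].

(* Law of X_i under N(theta0, sigma0sq); [sigma0sq] is a variance. *)
Definition P0 {R : realType} (theta0 sigma0sq : R) : set R -> \bar R :=
  normal_prob theta0 (Num.sqrt sigma0sq).

(* Main.v *)
(* The factor w(x) = E(1 - kappa | x) lies in [0, 1], and bounding the numerator
   and the marginal in Bayes' formula separately gives
   w(x) <= C tau^(2 eta) exp(x^2 / 2T), for any T > 0 and tau <= 1: since
   y / (1 + y) <= y^eta, the numerator is at most C tau^(2 eta) uniformly in x,
   while the marginal restricted to lambda^2 in [1/2, 1] and sigma^2 in [T, 2T]
   is at least c exp(-x^2 / 2T).  Taking T large compared with the true
   variances, Markov's inequality for exp((X - theta)^2 / 4S) bounds the i-th
   probability by C tau^(4 eta) / t when theta_i = 0 and by C / t otherwise, where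
   t = M_n q_n log(n / q_n).  As tau^(2 eta) = (q_n / n)^(1 + eps_n), both
   n tau^(4 eta) and the number of nonzero theta_i are at most q_n, so the sum is
   at most D / (M_n log(n / q_n)). *)
Require Import Defs.
From HB Require Import structures.
From mathcomp Require Import all_boot all_order all_algebra.
From mathcomp Require Import all_classical all_reals all_analysis.
From mathcomp Require Import measurable_realfun.
From mathcomp Require Import ring lra.

Set Implicit Arguments.
Unset Strict Implicit.
Unset Printing Implicit Defensive.

Import Order.TTheory GRing.Theory Num.Theory.
Import numFieldNormedType.Exports.

Local Open Scope classical_set_scope.
Local Open Scope ring_scope.

(* Not assuming measurability dispenses with proving that the partial integrals
   of the posterior and the map [theta_hat] are measurable. *)
Lemma ge0_le_integral_nomeas d (T : measurableType d) (R : realType)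
    (mu : {measure set T -> \bar R}) (D : set T) (f g : T -> \bar R) :
  (forall x, D x -> 0 <= f x)%E -> (forall x, D x -> f x <= g x)%E ->
  (\int[mu]_(x in D) f x <= \int[mu]_(x in D) g x)%E.
Proof.
move=> f0 fg.
have g0 x : D x -> (0 <= g x)%E by move=> Dx; rewrite (le_trans (f0 _ Dx))// fg.
rewrite !ge0_integralE//; apply: ge_ereal_sup => _ [h /= hf <-].
apply: ereal_sup_ubound; exists h => //= x; apply: (le_trans (hf x)).
by rewrite /patch; case: ifPn => // /set_mem; exact: fg.
Qed.

Lemma ge0_subset_integral_nomeas d (T : measurableType d) (R : realType)
    (mu : {measure set T -> \bar R}) (A D : set T) (f g : T -> \bar R) :
  A `<=` D -> (forall x, A x -> 0 <= f x)%E -> (forall x, D x -> 0 <= g x)%E ->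
  (forall x, A x -> f x <= g x)%E ->
  (\int[mu]_(x in A) f x <= \int[mu]_(x in D) g x)%E.
Proof.
move=> AD f0 g0 fg; rewrite integral_mkcond (integral_mkcond D).
apply: ge0_le_integral_nomeas => x _; rewrite /patch.
  by case: ifPn => // /set_mem; exact: f0.
case: ifPn => [/set_mem Ax|_]; first by rewrite mem_set; [exact: fg|exact: AD].
by case: ifPn => // /set_mem; exact: g0.
Qed.

(** * Power tails and the inverse gamma integral on the half-line *)

Section integrals.
Context {R : realType}.
Local Notation mu := (@lebesgue_measure R).
Implicit Types (s v x p : R).

Lemma integral_powR_y p : 1 < p ->
  (\int[mu]_(u in `[1%R, +oo[) (u `^ (- p))%:E = ((p - 1)^-1)%:E)%E.
Proof.
move=> p1.
have p10 : 1 - p != 0 by rewrite subr_eq0 lt_eqF.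
pose F u := (1 - p)^-1 * u `^ (1 - p).
have dF (u : R) : 0 < u -> is_derive u 1 F (u `^ (- p)).
  move=> u0.
  have := is_derive1_powR (1 - p) u0.
  have -> : 1 - p - 1 = - p by lra.
  case=> dp E; split; first by apply: (@derivableM _ R) => //; exact: derivable_cst.
  by rewrite deriveM// derive_cst scaler0 addr0 E scalerA mulVf// scale1r.
have F1 : F 1 = (1 - p)^-1 by rewrite /F powR1 mulr1.
rewrite (@ge0_continuous_FTC2y _ _ F _ 0).
- by rewrite F1 sub0e -EFinN -invrN opprB.
- by move=> u _; exact: powR_ge0.
- apply: continuous_in_subspaceT => u; rewrite inE/= in_itv/= andbT => u1.
  apply: differentiable_continuous; apply/derivable1_diffP.
  by apply: ex_derive; apply: is_derive1_powR; lra.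
- rewrite /F -(mulr0 (1 - p)^-1); apply: cvgM; first exact: cvg_cst.
  apply/cvgr0Pnorm_lt => e e0; near=> u.
  have r0 : 0 < p - 1 by rewrite subr_gt0.
  have u0 : 0 < u by near: u; exact: nbhs_pinfty_gt.
  (* The threshold solves [u^(1-p) = e]. *)
  have : e `^ (- (p - 1)^-1) < u by near: u; exact: nbhs_pinfty_gt.
  move=> /(gt0_ltr_powR r0); rewrite -powRrM mulNr mulVf ?gt_eqF// powR_inv1 ?ltW//.
  rewrite !nnegrE !powR_ge0 ltW// => /(_ isT isT) eu.
  rewrite ger0_norm ?powR_ge0// -opprB powRN.
  by rewrite -(invrK e) ltf_pV2// posrE ?invr_gt0// powR_gt0.
- by move=> u u1; have := dF u (lt_trans ltr01 u1); case.
- apply/cvg_at_right_filter/differentiable_continuous/derivable1_diffP.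
  by have := dF 1 ltr01; case.
- move=> u; rewrite in_itv/= andbT => u1; rewrite derive1E.
  by have := dF u (lt_trans ltr01 u1) => -[].
Unshelve. all: by end_near.
Qed.

(** Cutting at 1 isolates the two sources of divergence. It serves both for the moment of the prior
    and for the inverse gamma kernel, whose behaviours near 0 have different causes but whose tails
    are both powers. *)
Lemma integral_le_tail (f : R -> R) (A B p : R) : 1 < p ->
  (forall u, 0 < u -> 0 <= f u) ->
  measurable_fun (`]0, +oo[ : set R) f ->
  (\int[mu]_(u in `]0%R, 1%R]) (f u)%:E <= A%:E)%E ->
  (forall u, 1 <= u -> f u <= B * u `^ (- p)) ->
  (\int[mu]_(u in `]0%R, +oo[) (f u)%:E <= (A + B / (p - 1))%:E)%E.
Proof.
move=> p1 f0 mf fA fB.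
have D : (`]0, +oo[%classic : set R) = `]0, 1]%classic `|` `]1, +oo[%classic.
  by apply: itv_bndbnd_setU; rewrite bnd_simp.
have B0 : 0 <= B.
  by have := le_trans (f0 1 ltr01) (fB 1 (lexx 1)); rewrite powR1 mulr1.
rewrite D ge0_integral_setU//=; last 3 first.
- by rewrite -D; exact/measurable_EFinP.
- move=> u [] /=; rewrite in_itv/= lee_fin => u0; apply: f0; lra.
- apply/disj_setPS => u /=; rewrite !in_itv/= andbT => -[/andP[_ u1]].
  by rewrite ltNge u1.
rewrite EFinD leeD// EFinM -(integral_powR_y p1) -ge0_integralZl//.
- apply: ge0_subset_integral_nomeas.
  + by apply: subset_itvr; rewrite bnd_simp.
  + by move=> u /=; rewrite in_itv/= andbT => u1; rewrite lee_fin f0//; lra.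
  + by move=> u _; rewrite -EFinM lee_fin mulr_ge0// powR_ge0.
  + by move=> u /=; rewrite in_itv/= andbT => u1; rewrite -EFinM lee_fin fB// ltW.
- apply/measurable_EFinP; apply: measurable_funTS; exact: measurable_powR.
- by move=> u _; rewrite lee_fin powR_ge0.
Qed.

(** After taking logarithms this is [ln z < z] at [z = b / (s p)]. The bound is [(p/b)^p], the true
    maximum up to the factor [exp(-p)]. *)
Lemma powRN_expRN_le (p b s : R) : 0 < p -> 0 < b -> 0 < s ->
  s `^ (- p) * expR (- (b / s)) <= expR (p * ln (p / b)).
Proof.
move=> p0 b0 s0.
rewrite /powR (gt_eqF s0) -expRD ler_expR.
have := ln_sublinear (divr_gt0 (divr_gt0 b0 s0) p0).
rewrite !ln_div ?posrE ?divr_gt0// ltr_pdivlMr//; lra.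
Qed.

Lemma measurable_inv_gamma (p b : R) :
  measurable_fun (`]0, +oo[ : set R) (fun s : R => s `^ (- p) * expR (- (b / s))).
Proof.
apply: measurable_funM.
  by apply: measurable_funTS; exact: measurable_powR.
apply: measurableT_comp => //; apply: measurableT_comp => //.
apply: measurable_funM => //.
apply: (eq_measurable_fun (fun s : R => s `^ (-1))) => [s|].
  by rewrite inE/= in_itv/= andbT => s0; rewrite powR_inv1// ltW.
by apply: measurable_funTS; exact: measurable_powR.
Qed.

Lemma integral_inv_gamma_fin (p b : R) : 1 < p -> 0 < b ->
  exists2 J : R, 0 <= J &
  (\int[mu]_(s in `]0%R, +oo[) (s `^ (- p) * expR (- (b / s)))%:E <= J%:E)%E.
Proof.
move=> p1 b0; have p0 : 0 < p by lra.
have nd s : 0 < s -> expR (- (b / s)) <= 1.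
  by move=> s0; rewrite expR_le1 oppr_le0 ltW// divr_gt0.
exists (expR (p * ln (p / b)) + 1 / (p - 1)).
  by rewrite addr_ge0 ?expR_ge0// divr_ge0//; lra.
apply: integral_le_tail => //.
- by move=> s _; rewrite mulr_ge0 ?powR_ge0 ?expR_ge0.
- exact: measurable_inv_gamma.
- have m1 : mu `]0%R, 1%R] = 1%E.
    by rewrite lebesgue_measure_itv/= lte_fin ltr01 sube0.
  rewrite -[leRHS]mule1 -m1.
  rewrite -integral_cst//; apply: ge0_le_integral_nomeas => s /=.
    by move=> _; rewrite lee_fin mulr_ge0 ?powR_ge0 ?expR_ge0.
  by rewrite in_itv/= lee_fin => /andP[s0 _]; exact: powRN_expRN_le.
- by move=> s s1; rewrite mul1r ler_piMr ?powR_ge0// nd; lra.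
Qed.
End integrals.

(** * Gaussian densities: integrating out the mean, and bounds over a range of variances *)

Section normal_pdf.
Context {R : realType}.
Local Notation mu := (@lebesgue_measure R).

Lemma normal_pdf_sqrtE (m v x : R) : 0 < v ->
  normal_pdf m (Num.sqrt v) x =
  (Num.sqrt (v * pi *+ 2))^-1 * expR (- (x - m) ^+ 2 / (v *+ 2)).
Proof.
move=> v0; rewrite normal_pdfE ?gt_eqF ?sqrtr_gt0//.
by rewrite /normal_peak /normal_fun sqr_sqrtr// ltW.
Qed.

(* Completing the square in [t]. *)
Lemma normal_pdf_mul (s v x t : R) : 0 < s -> 0 < v ->
  normal_pdf t (Num.sqrt s) x * normal_pdf 0 (Num.sqrt v) t =
  normal_pdf 0 (Num.sqrt (s + v)) x *
  normal_pdf (v * x / (s + v)) (Num.sqrt (s * v / (s + v))) t.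
Proof.
move=> s0 v0.
have sv0 : 0 < s + v by rewrite addr_gt0.
have svn0 : s + v != 0 by rewrite gt_eqF.
have pi0 := @pi_gt0 R.
rewrite !normal_pdf_sqrtE ?divr_gt0 ?mulr_gt0// mulrACA [RHS]mulrACA -!invfM -!expRD.
rewrite -!sqrtrM ?mulrn_wge0 ?mulr_ge0 ?divr_ge0 ?mulr_ge0 ?ltW//.
congr ((Num.sqrt _)^-1 * expR _); field => //.
by rewrite svn0 !gt_eqF.
Qed.

Lemma integral_normal_pdf_mul (s v x c : R) : 0 < s -> 0 < v -> 0 <= c ->
  (\int[mu]_(t in [set: R])
    (c * (normal_pdf t (Num.sqrt s) x * normal_pdf 0 (Num.sqrt v) t))%:E)%E =
  (c * normal_pdf 0 (Num.sqrt (s + v)) x)%:E.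
Proof.
move=> s0 v0 c0.
under eq_integral do rewrite normal_pdf_mul// mulrA EFinM.
rewrite ge0_integralZl//.
- by rewrite integral_normal_pdf mule1.
- by apply/measurable_EFinP; exact: measurable_normal_pdf.
- by move=> t _; rewrite lee_fin normal_pdf_ge0.
- by rewrite lee_fin mulr_ge0// normal_pdf_ge0.
Qed.

(** Discarding the exponential makes the bound uniform in [x]; the price is an extra power -1/2 of
    [s], which the inverse gamma kernel absorbs. *)
Lemma normal_pdf0_le (s w x : R) : 0 < s -> s <= w ->
  normal_pdf 0 (Num.sqrt w) x <= s `^ (- 2^-1).
Proof.
move=> s0 sw; have w0 := lt_le_trans s0 sw.
rewrite normal_pdf_sqrtE// powRN powR12_sqrt; last exact: ltW.
rewrite -[leRHS]mulr1 ler_pM ?expR_ge0 ?invr_ge0//.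
  rewrite lef_pV2 ?posrE ?sqrtr_gt0 ?mulrn_wgt0 ?mulr_gt0 ?pi_gt0//.
  rewrite ler_sqrt ?mulrn_wge0 ?mulr_ge0 ?pi_ge0 ?ltW//.
  have := pi_ge2 R; nra.
by rewrite expR_le1 mulNr oppr_le0 divr_ge0 ?sqr_ge0 ?mulrn_wge0// ltW.
Qed.

(** The normalizing factor is smallest at the largest variance [t], the exponential at the smallest
    variance [s]. *)
Lemma normal_pdf0_ge (s w t x : R) : 0 < s -> s <= w -> w <= t ->
  (Num.sqrt (t * pi *+ 2))^-1 * expR (- (x ^+ 2 / (s *+ 2))) <=
  normal_pdf 0 (Num.sqrt w) x.
Proof.
move=> s0 sw wt; have w0 := lt_le_trans s0 sw; have t0 := lt_le_trans w0 wt.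
rewrite normal_pdf_sqrtE// ler_pM ?expR_ge0 ?invr_ge0//.
  rewrite lef_pV2 ?posrE ?sqrtr_gt0 ?mulrn_wgt0 ?mulr_gt0 ?pi_gt0//.
  rewrite ler_sqrt ?lerMn2r/= ?ler_pM2r ?pi_gt0//.
  by rewrite mulrn_wge0// mulr_ge0 ?pi_ge0// ltW.
rewrite ler_expR mulNr lerN2 subr0 ler_wpM2l ?sqr_ge0//.
by rewrite lef_pV2 ?posrE ?mulrn_wgt0// lerMn2r.
Qed.
End normal_pdf.

(* An infinite or vanishing denominator makes the quotient [0]. *)
Lemma fine_ratio_le {R : realType} (N D : \bar R) (r l G : R) :
  (0 <= N)%E -> (N <= D)%E -> 0 <= G -> 0 <= r ->
  (N <= (r * (G * l))%:E)%E -> ((G * l)%:E <= D)%E ->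
  0 <= fine N / fine D <= Num.min 1 r.
Proof.
move=> N0 ND G0 r0 Nr lD; have D0 := le_trans N0 ND.
rewrite divr_ge0 ?fine_ge0//= le_min.
case: D => [d| |] in ND lD D0 *; [|by rewrite /= invr0 mulr0 ler01 r0|by []].
case: N => [n| |] // in N0 ND Nr *; rewrite !lee_fin/= in N0 ND Nr lD D0 *.
have [->|dn0] := eqVneq d 0; first by rewrite invr0 mulr0 ler01 r0.
have d0 : 0 < d by rewrite lt_neqAle eq_sym dn0.
rewrite !ler_pdivrMr// mul1r ND/=.
by rewrite (le_trans Nr)// ler_wpM2l.
Qed.

(** * Posterior mean of the shrinkage weight *)

Section shrinkage.
Context {R : realType}.
Local Notation mu := (@lebesgue_measure R).
Variables (a K alpha beta Mbar eta : R) (L : R -> R).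
Hypotheses (a_gt0 : 0 < a) (K_gt0 : 0 < K) (alpha_gt0 : 0 < alpha)
  (beta_gt0 : 0 < beta)
  (L_nondecr : forall u v : R, 0 < u -> u <= v -> L u <= L v)
  (L_bounds : forall u : R, 0 < u -> 0 < L u <= Mbar)
  (prior_proper :
    (\int[mu]_(u in `]0%R, +oo[) (local_prior K a L u)%:E = 1)%E)
  (eta_gt0 : 0 < eta) (eta_lt_a : eta < a) (eta_le1 : eta <= 1).

Local Notation prior := (local_prior K a L).
Local Notation ig := (inv_gamma_pdf alpha beta).
Local Notation G := (beta `^ alpha / Gamma alpha).

Lemma local_prior_ge0 u : 0 < u -> 0 <= prior u.
Proof.
move=> u0; rewrite /local_prior !mulr_ge0 ?powR_ge0//; first exact: ltW.
by have /andP[/ltW] := L_bounds u0.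
Qed.

Lemma measurable_local_prior : measurable_fun (`]0, +oo[ : set R) prior.
Proof.
apply: measurable_funM.
  apply: measurable_funM => //.
  by apply: measurable_funTS; exact: measurable_powR.
(* Since [L] is positive, extending it by 0 keeps it nondecreasing on the whole line, hence
   measurable. *)
apply: (eq_measurable_fun (fun u : R => if 0 < u then L u else 0)) => [u|].
  by rewrite inE/= in_itv/= andbT => ->.
apply: nondecreasing_measurable => // u v uv.
have [u0|u0] := ltP 0 u.
  by rewrite (lt_le_trans u0 uv) L_nondecr.
by case: ifPn => // v0; have /andP[/ltW] := L_bounds v0.
Qed.

(** On []0, 1]] the factor [u^eta] is at most 1 and the prior has mass 1. Beyond 1, [L <= Mbar]
    leaves a power tail of exponent [a + 1 - eta], integrable because [eta < a]. *)
Lemma integral_powR_prior : exists2 C : R, 0 < C &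
  (\int[mu]_(u in `]0%R, +oo[) (u `^ eta * prior u)%:E <= C%:E)%E.
Proof.
have ea : 0 < a - eta by rewrite subr_gt0.
have M0 : 0 < Mbar by have /andP[] := L_bounds ltr01; exact: lt_le_trans.
exists (1 + (K * Mbar) / (a + 1 - eta - 1)).
  rewrite ltr_wpDr// divr_ge0//; first by rewrite mulr_ge0// ltW.
  by lra.
apply: integral_le_tail; first lra.
- by move=> u u0; rewrite mulr_ge0 ?powR_ge0 ?local_prior_ge0.
- apply: measurable_funM; last exact: measurable_local_prior.
  by apply: measurable_funTS; exact: measurable_powR.
- rewrite -prior_proper; apply: ge0_subset_integral_nomeas.
  + by apply: subset_itvl; rewrite bnd_simp.
  + move=> u /=; rewrite in_itv/= lee_fin => /andP[u0 _].
    by rewrite mulr_ge0 ?powR_ge0 ?local_prior_ge0.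
  + by move=> u /=; rewrite in_itv/= andbT lee_fin => /local_prior_ge0.
  + move=> u /=; rewrite in_itv/= lee_fin => /andP[u0 u1].
    rewrite ler_piMl ?local_prior_ge0// -(powRr0 u) ger_powR ?u0//; exact: ltW.
- move=> u u1; have u0 : 0 < u by lra.
  have -> : - (a + 1 - eta) = eta + (- a - 1) by lra.
  rewrite powRD ?(gt_eqF u0) ?implybT// /local_prior.
  have /andP[_ LM] := L_bounds u0.
  rewrite [leLHS](_ : _ = K * (u `^ eta * u `^ (- a - 1)) * L u); last by ring.
  by rewrite [leRHS]mulrAC ler_wpM2l// !mulr_ge0 ?powR_ge0// ltW.
Qed.

(** [G] is a common factor of the numerator and marginal bounds, so its sign is enough for it to
    drop out of their quotient. *)
Lemma inv_gamma_const_ge0 : 0 <= G.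
Proof.
rewrite divr_ge0 ?powR_ge0// fine_ge0// integral_ge0// => t _.
by rewrite lee_fin mulr_ge0 ?powR_ge0 ?expR_ge0.
Qed.

Lemma inv_gamma_pdf_ge0 s : 0 <= ig s.
Proof. by rewrite /inv_gamma_pdf mulr_ge0 ?expR_ge0// mulr_ge0 ?powR_ge0// inv_gamma_const_ge0. Qed.

(** Here [c] is [1 - kappa tau u] in the numerator and 1 in the marginal; neither depends on [th],
    so the mean integrates out and leaves the law of [X] given both variances. *)
Lemma integral_joint_pdf tau x u s c : 0 < tau -> 0 < u -> 0 < s -> 0 <= c ->
  (\int[mu]_(th in [set: R])
     (c * joint_pdf K a L alpha beta tau u s th x)%:E)%E =
  (c * prior u * ig s * normal_pdf 0 (Num.sqrt (s + s * u * tau ^+ 2)) x)%:E.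
Proof.
move=> t0 u0 s0 c0.
rewrite -integral_normal_pdf_mul ?mulr_gt0 ?exprn_gt0//; last first.
  by rewrite (mulr_ge0 (mulr_ge0 c0 (local_prior_ge0 u0))) ?inv_gamma_pdf_ge0.
by apply: eq_integral => th _; rewrite /joint_pdf; congr (_%:E); ring.
Qed.

Lemma kappa_range (tau u : R) : 0 < u -> 0 <= 1 - kappa tau u <= 1.
Proof.
move=> u0; have t0 := sqr_ge0 tau; have ut := mulr_ge0 (ltW u0) t0.
by rewrite subr_ge0 invf_le1 ?lerDl ?ut ?ltr_wpDr//= lerBlDr lerDl invr_ge0 addr_ge0.
Qed.

(** With [y = u tau^2] the left side is [y / (1 + y)]. It is at most [y <= y^eta] when [y <= 1], as
    [eta <= 1], and at most [1 <= y^eta] otherwise. *)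
Lemma one_sub_kappa_le (tau u : R) : 0 < u ->
  1 - kappa tau u <= (tau ^+ 2) `^ eta * u `^ eta.
Proof.
move=> u0; have t0 := sqr_ge0 tau; have ut := mulr_ge0 (ltW u0) t0.
rewrite -powRM ?(ltW u0)// mulrC.
rewrite /kappa; move: (u * tau ^+ 2) ut => y y0.
have [y1|y1] := leP y 1; last first.
  have y'1 : 1 <= y `^ eta by rewrite -(powRr0 y) ler_powR ?ltW.
  by rewrite (le_trans _ y'1)// gerBl invr_ge0; lra.
have [->|yn0] := eqVneq y 0; first by rewrite addr0 invr1 subrr powR_ge0.
apply: (@le_trans _ _ y); last by rewrite ger1_powR// lt_neqAle eq_sym yn0 y0 y1.
rewrite lerBlDr -lerBlDl -[leRHS]div1r ler_pdivlMr; last by rewrite ltr_wpDr.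
nra.
Qed.

(** This repeats the local [I] of [posterior_mean], so that its numerator and denominator can be
    bounded separately. *)
Let bayes tau x (h : R -> R -> R -> R) : \bar R :=
  (\int[mu]_(u in `]0%R, +oo[) \int[mu]_(s in `]0%R, +oo[)
     \int[mu]_(th in [set: R])
       (h u s th * joint_pdf K a L alpha beta tau u s th x)%:E)%E.

Let joint_ge0 tau x u s th : 0 < u -> 0 <= joint_pdf K a L alpha beta tau u s th x.
Proof.
move=> u0; rewrite /joint_pdf mulr_ge0 ?inv_gamma_pdf_ge0//.
by rewrite mulr_ge0 ?local_prior_ge0// mulr_ge0 ?normal_pdf_ge0.
Qed.

(** Once [th] is integrated out, the integrand is dominated by a function of [u] times a function of
    [s], so the double integral splits into a prior moment and an inverse gamma integral. *)
Let bayes_numerator_le : exists2 C : R, 0 < C & forall tau x, 0 < tau ->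
  (bayes tau x (fun u _ _ => (1 - kappa tau u)%R) <=
   (G * (C * (tau ^+ 2) `^ eta))%:E)%E.
Proof.
have [C C0 HC] := integral_powR_prior.
(* The exponent is [alpha + 1] from the prior plus 1/2 from [normal_pdf0_le]. *)
have p1 : 1 < alpha + 1 + 2^-1 by have := alpha_gt0; lra.
have [J J0 HJ] := integral_inv_gamma_fin p1 beta_gt0.
have G0 := inv_gamma_const_ge0.
(* [J] is only known to be nonnegative; adding 1 makes the constant positive. *)
exists (C * (J + 1)) => [|tau x t0]; first by rewrite mulr_gt0// ltr_wpDl.
pose t := (tau ^+ 2) `^ eta; have tt0 : 0 <= t by exact: powR_ge0.
apply: (@le_trans _ _ (\int[mu]_(u in `]0%R, +oo[)
    ((t * G * J)%:E * (u `^ eta * prior u)%:E))%E).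
  apply: ge0_le_integral_nomeas => u /=; rewrite in_itv/= andbT => u0.
    apply: integral_ge0 => s _; apply: integral_ge0 => th _.
    by rewrite lee_fin mulr_ge0 ?joint_ge0//; have /andP[] := kappa_range tau u0.
  have up0 : 0 <= u `^ eta * prior u by rewrite mulr_ge0 ?powR_ge0 ?local_prior_ge0.
  pose c := t * G * (u `^ eta * prior u).
  have c0 : 0 <= c by rewrite mulr_ge0// mulr_ge0.
  apply: (@le_trans _ _ (\int[mu]_(s in `]0%R, +oo[)
      (c%:E * (s `^ (- (alpha + 1 + 2^-1)) * expR (- (beta / s)))%:E))%E).
    apply: ge0_le_integral_nomeas => s /=; rewrite in_itv/= andbT => s0.
      apply: integral_ge0 => th _.
      by rewrite lee_fin mulr_ge0 ?joint_ge0//; have /andP[] := kappa_range tau u0.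
    have /andP[k0 _] := kappa_range tau u0.
    rewrite integral_joint_pdf// -EFinM lee_fin.
    have -> : - (alpha + 1 + 2^-1) = (- alpha - 1) + - 2^-1 by lra.
    rewrite powRD ?(gt_eqF s0) ?implybT//.
    have -> : c * (s `^ (- alpha - 1) * s `^ (- 2^-1) * expR (- (beta / s))) =
      t * u `^ eta * prior u * ig s * s `^ (- 2^-1).
      by rewrite /c /inv_gamma_pdf; ring.
    rewrite ler_pM ?normal_pdf_ge0 ?normal_pdf0_le//.
    - by rewrite (mulr_ge0 (mulr_ge0 k0 (local_prior_ge0 u0))) ?inv_gamma_pdf_ge0.
    - rewrite ler_wpM2r ?inv_gamma_pdf_ge0// ler_wpM2r ?local_prior_ge0//.
      exact: one_sub_kappa_le.
    - by rewrite lerDl !mulr_ge0 ?sqr_ge0 ?ltW.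
  rewrite ge0_integralZl//; last 2 first.
  - by apply/measurable_EFinP; exact: measurable_inv_gamma.
  - by move=> s _; rewrite lee_fin mulr_ge0 ?powR_ge0 ?expR_ge0.
  rewrite [leRHS](_ : _ = (c%:E * J%:E)%E).
    by rewrite lee_wpmul2l// lee_fin.
  by rewrite -!EFinM; congr (_%:E); rewrite /c; ring.
rewrite ge0_integralZl//; last 3 first.
- apply/measurable_EFinP; apply: measurable_funM; last exact: measurable_local_prior.
  by apply: measurable_funTS; exact: measurable_powR.
- move=> u /=; rewrite in_itv/= andbT => u0.
  by rewrite lee_fin mulr_ge0 ?powR_ge0 ?local_prior_ge0.
- by rewrite lee_fin mulr_ge0// mulr_ge0.
apply: (@le_trans _ _ ((t * G * J)%:E * C%:E)%E).
  by rewrite lee_wpmul2l// lee_fin mulr_ge0// mulr_ge0.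
rewrite -EFinM lee_fin -/t.
rewrite [leLHS](_ : _ = G * (C * J * t)); last by ring.
by rewrite ler_wpM2l// ler_wpM2r// ler_wpM2l ?(ltW C0)// lerDl.
Qed.

Let bayes_marginal_ge T : 0 < T -> exists2 l : R, 0 < l & forall tau x,
  0 < tau -> tau <= 1 ->
  ((G * (l * expR (- (x ^+ 2 / (T *+ 2)))))%:E <=
   bayes tau x (fun _ _ _ => 1%R))%E.
Proof.
move=> T0; have G0 := inv_gamma_const_ge0.
have TT0 : 0 < 2 * T by rewrite mulr_gt0.
have h0 : 0 < 2^-1 :> R by [].
have /andP[Lh0 _] := L_bounds h0.
(* Each factor is a lower bound on the box: [u^(-a-1) >= 1] and [L u >= L 2^-1] in [u], the extreme
   values at [2 * T] and [T] in [s], and [4 * T] as the largest variance of [X]. *)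
pose l := K * L 2^-1 * ((2 * T) `^ (- alpha - 1) * expR (- (beta / T))) *
  (Num.sqrt (4 * T * pi *+ 2))^-1.
have l0 : 0 < l.
  rewrite mulr_gt0 ?invr_gt0 ?sqrtr_gt0 ?mulrn_wgt0//; last first.
    by rewrite mulr_gt0 ?pi_gt0// mulr_gt0.
  by rewrite mulr_gt0 ?mulr_gt0 ?powR_gt0 ?expR_gt0.
(* The factor [T * 2^-1] is the area of the box. *)
exists (l * T * 2^-1) => [|tau x t0 t1]; first by rewrite (mulr_gt0 (mulr_gt0 l0 T0)).
pose e := expR (- (x ^+ 2 / (T *+ 2))); have e0 : 0 <= e by exact: expR_ge0.
have m1 : mu `[2^-1%R, 1%R] = (2^-1)%:E.
  by rewrite lebesgue_measure_itv/= lte_fin invf_lt1// ltr1n -EFinB; congr (_%:E); lra.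
have m2 : mu `[T, (2 * T)%R] = T%:E.
  by rewrite lebesgue_measure_itv/= lte_fin ltr_pMl// ltr1n -EFinB; congr (_%:E); lra.
apply: (@le_trans _ _ (\int[mu]_(u in `[2^-1%R, 1%R]) (G * l * e * T)%:E)%E).
  rewrite integral_cst// [X in (_ <= _ * X)%E]m1 -EFinM lee_fin.
  by rewrite -/e; move: (_ / Gamma _) (l) => g k; rewrite le_eqVlt; apply/orP; left;
    apply/eqP; ring.
have cst0 : 0 <= G * l * e by rewrite mulr_ge0// mulr_ge0// ltW.
apply: ge0_subset_integral_nomeas.
- by apply: subset_itv; rewrite bnd_simp.
- by move=> u _; rewrite lee_fin mulr_ge0// ltW.
- move=> u /=; rewrite in_itv/= andbT => u0.
  apply: integral_ge0 => s _; apply: integral_ge0 => th _.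
  by rewrite lee_fin mul1r joint_ge0.
move=> u /=; rewrite in_itv/= => /andP[u2 u1].
have u0 : 0 < u by rewrite (lt_le_trans h0).
apply: (@le_trans _ _ (\int[mu]_(s in `[T, (2 * T)%R]) (G * l * e)%:E)%E).
  by rewrite integral_cst// [X in (_ <= _ * X)%E]m2 -EFinM.
apply: ge0_subset_integral_nomeas.
- by apply: subset_itv; rewrite bnd_simp.
- by move=> s _; rewrite lee_fin.
- move=> s /=; rewrite in_itv/= andbT => s0.
  by apply: integral_ge0 => th _; rewrite lee_fin mul1r joint_ge0.
move=> s /=; rewrite in_itv/= => /andP[s1 s2].
have s0 : 0 < s by rewrite (lt_le_trans T0).
rewrite integral_joint_pdf// lee_fin mul1r.
have -> : G * l * e = K * L 2^-1 *
   (G * (2 * T) `^ (- alpha - 1) * expR (- (beta / T))) *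
   ((Num.sqrt (4 * T * pi *+ 2))^-1 * e) by rewrite /l; ring.
have a1 : 0 <= alpha + 1 by rewrite addr_ge0// ltW.
rewrite ler_pM//.
- rewrite (mulr_ge0 (ltW (mulr_gt0 K_gt0 Lh0)))// mulr_ge0 ?expR_ge0//.
  by rewrite mulr_ge0 ?powR_ge0.
- by rewrite mulr_ge0// invr_ge0.
- apply: ler_pM.
  + exact: ltW (mulr_gt0 K_gt0 Lh0).
  + by rewrite mulr_ge0 ?expR_ge0// mulr_ge0 ?powR_ge0.
  + apply: ler_pM; [exact: ltW|exact: ltW| |exact: L_nondecr].
    rewrite ler_peMr ?(ltW K_gt0)// -opprD powRN invf_ge1 ?powR_gt0//.
    apply: (@le_trans _ _ (1 `^ (a + 1))); last by rewrite powR1.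
    by rewrite ge0_ler_powR ?nnegrE ?addr_ge0// ltW.
  + rewrite /inv_gamma_pdf ler_pM ?expR_ge0//.
    * by rewrite mulr_ge0 ?powR_ge0.
    * rewrite ler_wpM2l// -opprD !powRN lef_pV2 ?posrE ?powR_gt0//.
      by rewrite ge0_ler_powR ?nnegrE// ltW.
    * by rewrite ler_expR lerN2 ler_pM2l// lef_pV2 ?posrE.
- apply: (@le_trans _ _ ((Num.sqrt (4 * T * pi *+ 2))^-1 *
                         expR (- (x ^+ 2 / (s *+ 2))))).
    rewrite ler_wpM2l ?invr_ge0// ler_expR lerN2 ler_wpM2l ?sqr_ge0//.
    by rewrite lef_pV2 ?posrE ?mulrn_wgt0// lerMn2r.
  apply: normal_pdf0_ge => //; first by rewrite lerDl !mulr_ge0 ?sqr_ge0 ?ltW.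
  (* As [u] and [tau] are at most 1, the variance [s + s u tau^2] is at most [2 s], hence at most
     [4 T]. *)
  have tau2 : tau ^+ 2 <= 1 by rewrite expr_le1// ltW.
  have : s * u * tau ^+ 2 <= s.
    by rewrite -mulrA ler_piMr ?(ltW s0)// mulr_ile1 ?sqr_ge0 ?(ltW u0).
  lra.
Qed.

(** [C] may depend on [T] but not on [tau] or [x]. The exponential bound serves the zero means, the
    trivial bound 1 the others. *)
Lemma posterior_shrinkage_bound T : 0 < T -> exists2 C : R, 0 < C &
  forall tau x, 0 < tau -> tau <= 1 ->
  0 <= posterior_mean K a L alpha beta tau (fun u _ _ => 1 - kappa tau u) x
    <= Num.min 1 (C * (tau ^+ 2) `^ eta * expR (x ^+ 2 / (T *+ 2))).
Proof.
move=> T0; have [C C0 HC] := bayes_numerator_le.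
have [l l0 Hl] := bayes_marginal_ge T0.
exists (C / l) => [|tau x t0 t1]; first exact: divr_gt0.
apply: (@fine_ratio_le _ _ _ _ (l * expR (- (x ^+ 2 / (T *+ 2)))) G).
- apply: integral_ge0 => u /=; rewrite in_itv/= andbT => u0.
  apply: integral_ge0 => s _; apply: integral_ge0 => th _.
  by rewrite lee_fin mulr_ge0 ?joint_ge0//; have /andP[] := kappa_range tau u0.
- apply: ge0_le_integral_nomeas => u /=; rewrite in_itv/= andbT => u0;
    have /andP[k0 k1] := kappa_range tau u0.
    apply: integral_ge0 => s _; apply: integral_ge0 => th _.
    by rewrite lee_fin mulr_ge0 ?joint_ge0.
  apply: ge0_le_integral_nomeas => s /=; rewrite in_itv/= andbT => s0.
    by apply: integral_ge0 => th _; rewrite lee_fin mulr_ge0 ?joint_ge0.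
  apply: ge0_le_integral_nomeas => th _; rewrite lee_fin.
    by rewrite mulr_ge0 ?joint_ge0.
  by rewrite ler_wpM2r ?joint_ge0.
- exact: inv_gamma_const_ge0.
- by rewrite mulr_ge0 ?expR_ge0// mulr_ge0 ?powR_ge0// divr_ge0// ltW.
- apply: (le_trans (HC tau x t0)); rewrite lee_fin expRN le_eqVlt; apply/orP; left.
  have := gt_eqF (expR_gt0 (x ^+ 2 / (T *+ 2))).
  move: (expR _) (_ / Gamma _) => y g /negbT y0.
  by apply/eqP; field; rewrite y0 gt_eqF.
- exact: Hl.
Qed.

End shrinkage.

(** * Exponential Markov bound and squared errors per coordinate *)

Section tails.
Context {R : realType}.
Local Notation mu := (@lebesgue_measure R).

(* [exp (d^2 / 4S)] times the N(th, s2) density is at most [sqrt 2] times the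
   N(th, 2 s2) density when [s2 <= S]. *)
Lemma P0_exp_markov (th s2 S C t : R) (A : set R) :
  0 < s2 -> s2 <= S -> 0 <= C -> 0 < t ->
  (forall x, A x -> t <= C * expR ((x - th) ^+ 2 / (4 * S))) ->
  (P0 th s2 A <= (Num.sqrt 2 * C / t)%:E)%E.
Proof.
move=> s0 sS C0 t0 HA; have S0 := lt_le_trans s0 sS.
have ss0 : 0 < 2 * s2 by rewrite mulr_gt0.
have c0 : 0 <= Num.sqrt 2 * C / t :> R.
  by rewrite divr_ge0 ?(ltW t0)// mulr_ge0.
rewrite /P0 /normal_prob -[leRHS]mule1.
rewrite -(integral_normal_pdf th (Num.sqrt (2 * s2))) -ge0_integralZl//; first last.
- by move=> x _; rewrite lee_fin normal_pdf_ge0.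
- by apply/measurable_EFinP; exact: measurable_normal_pdf.
apply: ge0_subset_integral_nomeas => //.
- by move=> x _; rewrite lee_fin normal_pdf_ge0.
- by move=> x _; rewrite -EFinM lee_fin mulr_ge0// normal_pdf_ge0.
move=> x /HA xA; rewrite -EFinM lee_fin !normal_pdf_sqrtE//.
have -> : 2 * s2 * pi *+ 2 = 2 * (s2 * pi *+ 2) :> R by ring.
rewrite (sqrtrM (s2 * pi *+ 2)) // invfM.
have s20 : Num.sqrt 2 != 0 :> R by rewrite gt_eqF// sqrtr_gt0.
have -> (p e : R) : Num.sqrt 2 * C / t * ((Num.sqrt 2)^-1 * p * e) = p * (C / t * e).
  by field; rewrite s20 gt_eqF.
rewrite ler_wpM2l ?invr_ge0// mulrAC ler_pdivlMr//.
rewrite mulrC -ler_pdivlMr ?expR_gt0//.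
apply: (le_trans xA); rewrite -(mulrA C) ler_wpM2l// -expRN -expRD ler_expR.
(* Doubling the variance gains [d / (4 s2)] in the exponent, which dominates [d / (4 S)]. *)
set d := (x - th) ^+ 2; have d0 : 0 <= d by exact: sqr_ge0.
have -> : - d / (2 * s2 *+ 2) - - d / (s2 *+ 2) = d / (4 * s2).
  by field; rewrite gt_eqF.
by rewrite ler_wpM2l// lef_pV2 ?posrE ?mulr_gt0// ler_pM2l.
Qed.

(** Case of a zero mean. Half of the exponent [x^2 / 4S] pays for [w^2], the other half absorbs
    [x^2] through [y <= exp y]; this dictates [T = 8 S]. *)
Lemma sqr_shrink_le (S c w x : R) : 0 < S -> 0 <= w ->
  w <= c * expR (x ^+ 2 / ((8 * S) *+ 2)) ->
  (w * x) ^+ 2 <= c ^+ 2 * (8 * S) * expR (x ^+ 2 / (4 * S)).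
Proof.
move=> S0 w0 wc.
have yE : x ^+ 2 = 8 * S * (x ^+ 2 / (8 * S)) by field; rewrite gt_eqF.
set y := x ^+ 2 / (8 * S) in yE.
have yexp : x ^+ 2 <= 8 * S * expR y.
  rewrite {1}yE ler_pM2l ?mulr_gt0//.
  by apply: le_trans (expR_ge1Dx y); rewrite lerDr.
have -> : x ^+ 2 / (4 * S) = y + y by rewrite /y; field; rewrite gt_eqF.
have w2 : w ^+ 2 <= c ^+ 2 * expR y.
  apply: (@le_trans _ _ ((c * expR (x ^+ 2 / ((8 * S) *+ 2))) ^+ 2)).
    by rewrite lerXn2r// nnegrE (le_trans w0).
  rewrite exprMn -expRM_natl le_eqVlt; apply/orP; left; apply/eqP.
  by congr (_ * expR _); rewrite /y; field; rewrite gt_eqF.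
rewrite exprMn expRD; apply: (le_trans (ler_pM _ _ w2 yexp)); rewrite ?sqr_ge0//.
by rewrite le_eqVlt; apply/orP; left; apply/eqP; ring.
Qed.

(** Case of a nonzero mean. The error is a convex combination of [x - th] and [- th], so convexity
    of the square bounds it for any weight in [0, 1]. *)
Lemma sqr_error_le (S B w x th : R) : 0 < S -> 0 <= w <= 1 -> `|th| <= B ->
  (w * x - th) ^+ 2 <= (4 * S + B ^+ 2) * expR ((x - th) ^+ 2 / (4 * S)).
Proof.
move=> S0 /andP[w0 w1] thB; have B0 : 0 <= B by rewrite (le_trans _ thB).
have th2 : th ^+ 2 <= B ^+ 2 by rewrite -(real_normK (num_real th)) lerXn2r.
set d := x - th.
have yE : d ^+ 2 = 4 * S * (d ^+ 2 / (4 * S)) by field; rewrite gt_eqF.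
set y := d ^+ 2 / (4 * S) in yE *.
have e1 : 1 + y <= expR y := expR_ge1Dx y.
have y0 : 0 <= y by rewrite divr_ge0 ?sqr_ge0// mulr_ge0// ltW.
have -> : w * x - th = w * d - (1 - w) * th by rewrite /d; ring.
have := sqr_ge0 (d + th); have := sqr_ge0 d; have := sqr_ge0 th => t0 d0 dt0.
have conv : (w * d - (1 - w) * th) ^+ 2 <= d ^+ 2 + th ^+ 2.
  have -> : (w * d - (1 - w) * th) ^+ 2 =
    w * d ^+ 2 + (1 - w) * th ^+ 2 - w * (1 - w) * (d + th) ^+ 2 by ring.
  have : 0 <= w * (1 - w) * (d + th) ^+ 2.
    by rewrite mulr_ge0// mulr_ge0// subr_ge0.
  have : w * d ^+ 2 <= d ^+ 2 by rewrite ler_piMl.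
  have : (1 - w) * th ^+ 2 <= th ^+ 2 by rewrite ler_piMl// gerBl.
  lra.
apply: (le_trans conv); rewrite mulrDl lerD//.
  rewrite yE ler_wpM2l ?mulr_ge0 ?(ltW S0)//; lra.
by apply: (le_trans th2); rewrite ler_peMr ?sqr_ge0//; lra.
Qed.

Lemma sum_P0_shrink_le (n : nat) (S B c D q t : R) (w : R -> R)
    (s2 theta : 'I_n -> R) :
  0 < S -> 0 < t ->
  (forall x, 0 <= w x <= Num.min 1 (c * expR (x ^+ 2 / ((8 * S) *+ 2)))) ->
  n%:R * c ^+ 2 <= D * q ->
  (forall i, 0 < s2 i <= S) -> nearly_black q theta ->
  (forall i, `|theta i| <= B) ->
  (\sum_(i < n) P0 (theta i) (s2 i)
     [set x : R | ((w x * x - theta i) ^+ 2 > t)%R] <=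
   (Num.sqrt 2 * ((4 * S + B ^+ 2) + 8 * S * D) * q / t)%:E)%E.
Proof.
move=> S0 t0 wb cD sS nb thB.
(* Summed over [i], the first term is controlled by [cD], and the indicators add up to at most [q]
   by near-blackness. *)
pose C i := c ^+ 2 * (8 * S) + (4 * S + B ^+ 2) * (theta i != 0)%:R.
have c80 : 0 <= c ^+ 2 * (8 * S) by rewrite mulr_ge0 ?sqr_ge0// mulr_ge0// ltW.
have S40 : 0 <= 4 * S + B ^+ 2 by rewrite addr_ge0 ?sqr_ge0// mulr_ge0// ltW.
have C0 i : 0 <= C i by rewrite addr_ge0// mulr_ge0.
apply: (@le_trans _ _ (\sum_(i < n) (Num.sqrt 2 * C i / t)%:E)%E).
  apply: lee_sum => i _; have /andP[s0 siS] := sS i.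
  apply: (@P0_exp_markov _ _ S) => // x /= tx; apply: (le_trans (ltW tx)).
  have /andP[w0] := wb x; rewrite le_min => /andP[w1 wc].
  have := expR_ge0 ((x - theta i) ^+ 2 / (4 * S)) => e0.
  rewrite /C; have [th0|th0] := eqVneq (theta i) 0.
    rewrite th0 mulr0 addr0 !subr0; exact: sqr_shrink_le.
  rewrite mulr1; apply: (@le_trans _ _ ((4 * S + B ^+ 2) *
      expR ((x - theta i) ^+ 2 / (4 * S)))).
    by apply: sqr_error_le => //; rewrite w0.
  by rewrite ler_wpM2r// lerDr.
rewrite sumEFin lee_fin -mulr_suml -mulr_sumr ler_pM2r ?invr_gt0// -mulrA.
rewrite ler_wpM2l// /C big_split/= sumr_const card_ord -mulr_sumr.
rewrite -(mulr_natl (c ^+ 2 * _)) [leRHS]mulrDl addrC lerD//; first exact: ler_wpM2l.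
by rewrite mulrA [leLHS]mulrC -(mulrA (8 * S)) ler_wpM2l// mulr_ge0// ltW.
Qed.

End tails.

(** * Choice of constants and passage to the limit *)

Theorem theorem3p2 (R : realType)
  (a K alpha beta Mbar : R) (L : R -> R)
  (a_gt0 : 0 < a) (K_gt0 : 0 < K) (alpha_gt0 : 0 < alpha) (beta_gt0 : 0 < beta)
  (L_sv : slowly_varying L)
  (L_nondecr : forall u v : R, 0 < u -> u <= v -> L u <= L v)
  (L_bounds : forall u : R, 0 < u -> 0 < L u <= Mbar)
  (prior_proper :
    (\int[lebesgue_measure]_(u in `]0%R, +oo[) (local_prior K a L u)%:E = 1)%E)
  (sigma0sq : forall n : nat, 'I_n -> R)
  (sigma0sq_gt0 : forall (n : nat) (i : 'I_n), 0 < sigma0sq n i)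
  (sigma0sq_O1 : (fun n : nat => \big[Num.max/0]_(i < n) sigma0sq n i)
                   =O_\oo (fun _ : nat => 1 : R))
  (q : nat -> R)
  (q_gt0 : forall n : nat, 0 < q n)
  (q_on : q =o_\oo (fun n : nat => n%:R : R))
  (alpha_range : a + 1 < alpha < a + 2)
  (B : R) (B_ge0 : 0 <= B)
  (eta : R) (eta_range : 0 < eta < Num.min a (1 / 2))
  (eps tau M : nat -> R)
  (eps_to0 : eps n @[n --> \oo] --> (0 : R))
  (tauE : forall n : nat, (0 < n)%N ->
    tau n = (q n / n%:R) `^ (1 / (2 * eta) * (1 + eps n)))
  (M_toy : M n @[n --> \oo] --> +oo) :
  ereal_sup
    [set (\sum_(i < n)
            P0 (theta0 i) (sigma0sq n i)
              [set x : R | ((theta_hat K a L alpha beta (tau n) x - theta0 i) ^+ 2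
                              > M n * q n * ln (n%:R / q n))%R])%E
      | theta0 in [set theta0 : 'I_n -> R |
                    nearly_black (q n) theta0 /\
                    forall i : 'I_n, `|theta0 i| <= B]]
    @[n --> \oo] --> (0 : \bar R)%E.
Proof.
have /andP[eta0] := eta_range; rewrite lt_min => /andP[eta_a eta_h].
have eta1 : eta <= 1 by lra.
have [S S0 HS] : exists2 S : R, 0 < S & \forall n \near \oo, forall i, sigma0sq n i <= S.
  have /eqO_exP[S /= S0 HS] := sigma0sq_O1; exists S => //.
  near=> n => i; have : `|\big[Num.max/0]_(i < n) sigma0sq n i| <= S * `|1 : R|.
    by near: n; exact: HS.
  rewrite normr1 mulr1; apply: le_trans; apply: (le_trans _ (ler_norm _)).
  exact: le_bigmax.
have T0 : 0 < 8 * S by rewrite mulr_gt0.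
have [C C0 HC] := posterior_shrinkage_bound a_gt0 K_gt0 alpha_gt0 beta_gt0
  L_nondecr L_bounds prior_proper eta0 eta_a eta1 T0.
pose D := Num.sqrt 2 * ((4 * S + B ^+ 2) + 8 * S * C ^+ 2).
have D0 : 0 <= D.
  by rewrite /D !(mulr_ge0, addr_ge0, sqr_ge0, sqrtr_ge0)// ltW.
(* The logarithm is eventually at least 1, so the upper bound can do without it. *)
apply: (@squeeze_cvge _ _ _ _ (cst 0%E) _ (fun n => (D * (M n)^-1)%:E)).
- near=> n; apply/andP; split.
    (* The zero vector is admissible, so the supremum is over a nonempty set and is not [-oo]. *)
    apply: (@le_trans _ _ (\sum_(i < n) P0 0 (sigma0sq n i)
        [set x : R | ((theta_hat K a L alpha beta (tau n) x - 0) ^+ 2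
                        > M n * q n * ln (n%:R / q n))%R])%E).
      apply: sume_ge0 => i _; apply: integral_ge0 => x _.
      by rewrite lee_fin normal_pdf_ge0.
    apply: ereal_sup_ubound; exists (fun=> 0) => //; split => [|i].
      by rewrite /nearly_black/= big1 ?ltW// => i _; rewrite eqxx.
    by rewrite normr0.
  have n0 : (0 < n)%N by near: n; exists 1%N.
  have nR : 0 < n%:R :> R by rewrite ltr0n.
  have q0 := q_gt0 n; have r0 : 0 < q n / n%:R by rewrite divr_gt0.
  have re : q n / n%:R <= expR (-1).
    rewrite ler_pdivrMr// -(ger0_norm (ltW q0)) -[n%:R](ger0_norm (ltW nR)).
    near: n; have /eqoP := q_on; apply; exact: expR_gt0.
  have sS : forall i, sigma0sq n i <= S by near: n; exact: HS.
  have M1 : 1 <= M n by near: n; exact: (cvgryPge _).1 M_toy 1.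
  (* This gives [1 + eps n >= 0], used for [tau n <= 1], and [2 (1 + eps n) >= 1], used in [cD]. *)
  have e1 : `|eps n| <= 2^-1.
    by near: n; have /cvgr0Pnorm_le := eps_to0; apply; rewrite invr_gt0.
  have r1 : q n / n%:R <= 1 by rewrite (le_trans re)// expR_le1 lerN10.
  have ln1 : 1 <= ln (n%:R / q n).
    have e_le : expR 1 <= n%:R / q n.
      by rewrite ler_pdivlMr// -ler_pdivlMl ?expR_gt0// -expRN -ler_pdivrMr.
    by rewrite -[leLHS](expRK 1) ler_ln ?posrE ?expR_gt0 ?divr_gt0.
  move: e1; rewrite ler_norml => /andP[e1 _].
  have tau0 : 0 < tau n by rewrite tauE// powR_gt0.
  have ex0 : 0 <= 1 / (2 * eta) * (1 + eps n).
    by rewrite mulr_ge0 ?divr_ge0 ?mulr_ge0 ?(ltW eta0)//; lra.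
  have tau1 : tau n <= 1.
    by rewrite tauE// -[leRHS](powRr0 (q n / n%:R)) ger_powR ?r0.
  have t2 : (tau n ^+ 2) `^ eta = (q n / n%:R) `^ (1 + eps n).
    rewrite tauE// -powR_mulrn ?powR_ge0// -!powRrM; congr (_ `^ _).
    by field; rewrite gt_eqF.
  (* The square is a power of [q n / n] with exponent [2 (1 + eps n) >= 1] and base at most 1, hence
     at most [q n / n]. *)
  have cD : n%:R * (C * (tau n ^+ 2) `^ eta) ^+ 2 <= C ^+ 2 * q n.
    rewrite t2 exprMn mulrCA ler_wpM2l ?sqr_ge0// -ler_pdivlMl// mulrC.
    rewrite -powR_mulrn ?powR_ge0// -powRrM ge1r_powR ?r0//; lra.
  have t0 : 0 < M n * q n * ln (n%:R / q n).
    by rewrite mulr_gt0 ?mulr_gt0//; lra.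
  apply: ge_ereal_sup => _ [theta [nb thB] <-].
  apply: (le_trans (sum_P0_shrink_le S0 t0 _ cD _ nb thB)).
  + by move=> x; exact: HC.
  + by move=> i; rewrite sigma0sq_gt0 sS.
  rewrite lee_fin -/D -(mulrA D) ler_wpM2l// ler_pdivrMr// -(mulrA (M n)).
  by rewrite mulKf ?gt_eqF ?(lt_le_trans ltr01 M1)// ler_peMr// ltW.
- exact: cvg_cst.
- apply: cvg_EFin; first exact: nearW.
  rewrite -(mulr0 D); apply: cvgM; first exact: cvg_cst.
  apply/gtr0_cvgV0 => //; near=> n; near: n.
  exact: (cvgryPgt _).1 M_toy 0.
Unshelve. all: by end_near.
Qed.
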